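(* Let $G$ be a connected bipartite graph with partite sets $A,B$ such that $|A|\ge |B|$. Then for any graph $H$, $$\xi(G\odot H)=|B|\,\mathrm{n}(H)+|A|.$$
   Context: All graphs are finite, simple and undirected; $\mathrm{n}(H)$ denotes the order of $H$. For a connected graph $\Gamma$, a set $S\subseteq V(\Gamma)$ is a distance-equalizer set if for every two distinct $u,v\in V(\Gamma)\setminus S$ there is $w\in S$ with $d_\Gamma(w,u)=d_\Gamma(w,v)$; $\xi(\Gamma)$ is the minimum cardinality of a distance-equalizer set of $\Gamma$. For $V(G)=\{v_1,\dots,v_n\}$, the corona product $G\odot H$ is obtained from $G$ and $n$ pairwise disjoint copies $H_1,\dots,H_n$ of $H$ by joining $v_i$ to every vertex of $H_i$. *)

(* Defs.v *)
From mathcomp Require Import all_boot.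

Set Implicit Arguments.
Unset Strict Implicit.
Unset Printing Implicit Defensive.

Record sgraph := SGraph {
  vertex :> finType;
  adj : rel vertex;
  adj_sym : symmetric adj;
  adj_irrefl : irreflexive adj
}.

Definition graph_order (G : sgraph) : nat := #|G|.

Definition connected_graph (G : sgraph) : Prop :=
  0 < graph_order G /\ forall x y : G, connect (@adj G) x y.

Definition bipartition (G : sgraph) (A B : {set G}) : Prop :=
  [/\ A :|: B = [set: G],
      [disjoint A & B],
      {in A &, forall x y, ~~ adj x y}
    & {in B &, forall x y, ~~ adj x y}].

Definition walk (G : sgraph) (k : nat) (x y : G) : bool :=
  [exists p : k.-tuple G, path (@adj G) x p && (last x p == y)].

(* The length of a shortest walk. Vertices joined by a walk are joined by one *)
(* of length less than the order of G, so the search bound is harmless (see   *)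
(* [distP]); the value is the order of G if x and y are not connected.        *)
Definition dist (G : sgraph) (x y : G) : nat :=
  find (fun k => walk k x y) (iota 0 (graph_order G)).

Lemma distP (G : sgraph) (x y : G) : connect (@adj G) x y ->
  walk (dist x y) x y /\ (forall k, walk k x y -> dist x y <= k).
Proof.
move=> /connectP[p0 p0P ylast].
case: (shortenP p0P) ylast => p pP Up _ ylast.
have szp : size p < graph_order G.
  by have := max_card (mem (x :: p)); rewrite (card_uniqP Up).
have wp : walk (size p) x y.
  by apply/existsP; exists (in_tuple p); rewrite /= pP ylast eqxx.
have hasw : has (fun k => walk k x y) (iota 0 (graph_order G)).
  by apply/hasP; exists (size p); rewrite ?mem_iota.
have ltd : dist x y < graph_order G by move: hasw; rewrite has_find size_iota.
split=> [|k wk]; first by have := nth_find 0 hasw; rewrite nth_iota.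
rewrite leqNgt; apply/negP=> ltk.
have := before_find 0 ltk; rewrite nth_iota ?add0n ?wk //.
exact: ltn_trans ltk ltd.
Qed.

Definition distance_equalizer (G : sgraph) (S : {set G}) : bool :=
  [forall u in ~: S, forall v in ~: S,
     (u != v) ==> [exists w in S, dist w u == dist w v]].

Lemma distance_equalizerT (G : sgraph) : distance_equalizer [set: G].
Proof. by apply/forall_inP=> u; rewrite inE in_setT. Qed.

(* [arg min] needs a witness that the range is nonempty: the full vertex set  *)
(* works by [distance_equalizerT].                                            *)
Definition xi (G : sgraph) : nat :=
  #|[arg min_(S < [set: G] | distance_equalizer S) #|S|]|.

Section Corona.
Variables G H : sgraph.

(* [inl v] is the vertex v of G; [inr (v, h)] is the copy of the vertex h of  *)
(* H in the copy of H attached to v.                                          *)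
Definition corona_adj : rel (G + G * H)%type := fun a b =>
  match a, b with
  | inl x, inl y => adj x y
  | inl x, inr (y, _) => x == y
  | inr (x, _), inl y => x == y
  | inr (x, h), inr (y, k) => (x == y) && adj h k
  end.

Lemma corona_adj_sym : symmetric corona_adj.
Proof.
move=> [x|[x h]] [y|[y k]] //=; first exact: adj_sym.
by rewrite eq_sym adj_sym.
Qed.

Lemma corona_adj_irrefl : irreflexive corona_adj.
Proof. by move=> [x|[x h]] /=; rewrite adj_irrefl ?andbF. Qed.

Definition corona : sgraph := SGraph corona_adj_sym corona_adj_irrefl.
End Corona.

(* Main.v *)
Require Import Defs.
From mathcomp Require Import all_boot zify.

(** Two-colour the corona by [side], which extends the bipartition of [G] so
    that every edge outside the copies of [H] changes colour. Distances then
    have the expected parity, except between two vertices of the same copy.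

    Upper bound: the colour class [A + copies over B] is a distance equalizer.
    Two vertices of the other class in different copies are at even distance,
    and a midpoint of a geodesic equalizes them; if the midpoint has the wrong
    colour, it is exchanged for a vertex of the copy attached to it, or for the
    vertex of [G] to which its copy is attached.

    Lower bound: by parity, vertices of different colours are equalized only if
    they are [x] and [(x, h)], and then only by some [(x, k)]. So the complement
    of an equalizer either lies in a colour class or has at most [n(H)] elements. *)

Set Implicit Arguments.
Unset Strict Implicit.
Unset Printing Implicit Defensive.

(** * Geodesics, Lipschitz bounds and parity of distances in a connected graph *)

Section Distance.
Variable G : sgraph.
Implicit Types (x y z : G) (p : seq G).

Lemma dist_le_path x p : path (@adj G) x p -> dist x (last x p) <= size p.
Proof.
move=> pP; have xp : connect (@adj G) x (last x p) by apply/connectP; exists p.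
apply: (distP xp).2; apply/existsP; exists (in_tuple p).
by rewrite /= pP eqxx.
Qed.

Lemma dist_adj x y : adj x y -> dist x y <= 1.
Proof. by move=> xy; apply: (@dist_le_path x [:: y]); rewrite /= xy. Qed.

Lemma distxx x : dist x x = 0.
Proof. by apply/eqP; rewrite -leqn0; apply: (@dist_le_path x [::]). Qed.

Lemma path_lipschitz (f : G -> nat) x p :
    (forall a b, adj a b -> f b <= (f a).+1) -> path (@adj G) x p ->
  f (last x p) <= f x + size p.
Proof.
move=> fL; elim: p x => [|y p IHp] x /=; first by rewrite addn0.
by case/andP=> /fL fxy /IHp; lia.
Qed.

Hypothesis Gc : forall x y, connect (@adj G) x y.

Lemma dist_path x y :
  exists p, [/\ path (@adj G) x p, last x p = y & size p = dist x y].
Proof.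
have [/existsP[p /andP[pP /eqP py]] _] := distP (Gc x y).
by exists p; rewrite size_tuple.
Qed.

Lemma dist_eq0 x y : dist x y = 0 -> x = y.
Proof. by have [[|z p] [_ <- <-]] := dist_path x y. Qed.

Lemma dist_triangle y x z : dist x z <= dist x y + dist y z.
Proof.
have [p [pP py <-]] := dist_path x y; have [q [qP qz <-]] := dist_path y z.
rewrite -size_cat -qz -py -last_cat; apply: dist_le_path.
by rewrite cat_path pP py.
Qed.

Lemma dist_sym x y : dist x y = dist y x.
Proof.
suff le_dist (a b : G) : dist a b <= dist b a by apply/eqP; rewrite eqn_leq !le_dist.
have [p [pP pa <-]] := dist_path b a.
have rP : path (@adj G) a (rev (belast b p)).
  by rewrite -pa rev_path (eq_path (e' := @adj G)) // => u v; apply: adj_sym.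
have := dist_le_path rP; rewrite size_rev size_belast.
by case: p {pP rP} pa => [<- //|c p] _ /=; rewrite rev_cons last_rcons.
Qed.

Lemma dist_adj_le x y z : adj y z -> dist x z <= (dist x y).+1.
Proof.
by move=> yz; have := dist_triangle y x z; have := dist_adj yz; lia.
Qed.

(** Used for lower bounds on distances: it suffices to exhibit a potential [f] that grows by at most
    one along each edge. *)
Lemma dist_lipschitz (f : G -> nat) x y :
  (forall a b, adj a b -> f b <= (f a).+1) -> f y <= f x + dist x y.
Proof.
by move=> fL; have [p [pP <- <-]] := dist_path x y; apply: path_lipschitz.
Qed.

Lemma dist_split x y k l :
  dist x y = k + l -> exists z, dist x z = k /\ dist z y = l.
Proof.
move=> dxy; have [p [pP py sp]] := dist_path x y; exists (last x (take k p)).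
have := pP; rewrite -{1}(cat_take_drop k p) cat_path => /andP[p1P p2P].
have := dist_le_path p1P; have := dist_le_path p2P.
rewrite -last_cat cat_take_drop py size_take size_drop.
by have := dist_triangle (last x (take k p)) x y; case: ifP; lia.
Qed.

Lemma odd_dist (c : G -> bool) x y :
  (forall a b, adj a b -> c a = ~~ c b) -> odd (dist x y) = c x (+) c y.
Proof.
move=> cP; have [p [pP <- <-]] := dist_path x y.
elim: p x pP => [|z p IHp] x /=; first by rewrite addbb.
by case/andP=> /cP-> /IHp->; case: (c z); case: (c _).
Qed.

End Distance.

Lemma xi_eq (G : sgraph) (S : {set G}) :
    distance_equalizer S ->
    (forall S' : {set G}, distance_equalizer S' -> #|S| <= #|S'|) ->
  xi G = #|S|.
Proof.
move=> eqS minS; rewrite /xi; case: arg_minnP => [|S' eqS' minS'].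
  exact: distance_equalizerT.
by apply/eqP; rewrite eqn_leq minS' ?minS.
Qed.

(** * Distances in the corona *)

Section CoronaDistance.
Variables G H : sgraph.
Hypothesis Gc : forall x y : G, connect (@adj G) x y.
Local Notation V := (corona G H).
Implicit Types (x y : G) (h k : H) (u v w z : V).

Definition in_copy x z := if z is inr p then p.1 == x else false.

Definition base z : G := match z with inl x => x | inr p => p.1 end.

Lemma corona_connected u v : connect (@adj V) u v.
Proof.
have up z : connect (@adj V) z (inl (base z)).
  case: z => [x|[x h]] /=; first exact: connect0.
  by apply: connect1; rewrite /= eqxx.
have csym : connect_sym (@adj V) by apply: sym_connect_sym; apply: adj_sym.
apply: connect_trans (up u) _; rewrite csym; apply: connect_trans (up v) _.
have /connectP[p pP ->] := Gc (base v) (base u).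
apply/connectP; exists (map inl p); last by rewrite last_map.
by rewrite path_map.
Qed.

Let Vc := corona_connected.

(** The projection [base] sends each edge to an edge or to a single vertex, so detours through
    copies never shorten a path. *)
Lemma corona_dist_inl x y : dist (inl x : V) (inl y) = dist x y.
Proof.
apply/eqP; rewrite eqn_leq; apply/andP; split.
  have [p [pP py <-]] := dist_path Gc x y.
  have := @dist_le_path V (inl x) (map inl p).
  by rewrite path_map last_map size_map py => /(_ pP).
have := @dist_lipschitz V Vc (fun z => dist x (base z)) (inl x) (inl y).
rewrite /= distxx add0n; apply.
move=> [a|[a h]] [b|[b k]] /=; first exact: dist_adj_le.
- by move=> /eqP->.
- by move=> /eqP->.
- by case/andP=> /eqP->.
Qed.

(** Every path leaving the copy passes through [inl x]. The potential [f], zero on the copy, turns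
    this into a Lipschitz bound. *)
Lemma corona_dist_copy x h z :
  ~~ in_copy x z -> dist (inr (x, h) : V) z = (dist (inl x : V) z).+1.
Proof.
move=> zx; apply/eqP; rewrite eqn_leq; apply/andP; split.
  apply: leq_trans (dist_triangle Vc (inl x) _ _) _.
  by rewrite -add1n leq_add2r dist_adj //= eqxx.
pose f u := if in_copy x u then 0 else (dist (inl x : V) u).+1.
have := @dist_lipschitz V Vc f (inr (x, h)) z.
rewrite /f /= eqxx (negPf zx) add0n; apply=> u v uv.
case: ifP => // vx; case: ifP => ux; last by rewrite ltnS dist_adj_le.
case: u ux uv => [//|[a h1]] /= /eqP->.
case: v vx => [b|[b h2]] /=; first by move=> _ /eqP->; rewrite distxx.
by move=> bx; rewrite eq_sym bx.
Qed.

Lemma corona_dist_same_copy x z w :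
  in_copy x z -> in_copy x w -> dist z w <= 2.
Proof.
case: z w => [//|[a h]] [//|[b k]] /= /eqP-> /eqP->.
apply: leq_trans (dist_triangle Vc (inl x) _ _) _.
by rewrite (leq_add (n1 := 1) (n2 := 1)) // dist_adj //= eqxx.
Qed.

(** * The two-colouring and distance equalizers *)

Section Sides.
Variable c : G -> bool.
Hypothesis cP : forall x y, adj x y -> c x = ~~ c y.

Definition side z := match z with inl x => c x | inr p => ~~ c p.1 end.

Lemma in_copy_side x z : in_copy x z -> side z = ~~ c x.
Proof. by case: z => [//|[y h]] /= /eqP->. Qed.

(** Edges inside copies keep their colour, so [odd_dist] applies only in [G]; a vertex of a copy is
    one step beyond its base. *)
Lemma odd_dist_inl x z : odd (dist (inl x : V) z) = c x (+) side z.
Proof.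
case: z => [y|[y h]] /=; first by rewrite corona_dist_inl (odd_dist Gc _ _ cP).
rewrite (dist_sym Vc) corona_dist_copy //= corona_dist_inl (odd_dist Gc _ _ cP).
by case: (c x); case: (c y).
Qed.

Lemma odd_dist_copy x h z :
  ~~ in_copy x z -> odd (dist (inr (x, h) : V) z) = ~~ c x (+) side z.
Proof.
by move=> zx; rewrite corona_dist_copy //= odd_dist_inl addNb.
Qed.

(** The common distance is at most 2, so [v] is within 1 of [inl x]; by parity that distance is
    even, hence 0. *)
Lemma equidistant_from_copy x h u v : side u != side v -> in_copy x u ->
  dist (inr (x, h) : V) u = dist (inr (x, h) : V) v -> v = inl x.
Proof.
move=> uv ux duv; have su := in_copy_side ux.
have vx : ~~ in_copy x v by apply: contra uv => /in_copy_side->; rewrite su.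
have := @corona_dist_same_copy x (inr (x, h)) u (eqxx x) ux.
rewrite duv corona_dist_copy // ltnS => dv.
have := odd_dist_inl x v.
have -> : c x (+) side v = false by move: uv; rewrite su; case: (c x) (side v) => [] [].
move=> ev; suff /(dist_eq0 Vc) : dist (inl x : V) v = 0 by [].
by move: dv ev; case: (dist _ _) => [|[|]].
Qed.

Lemma equidistant_opposite_sides w u v :
    side u != side v -> dist w u = dist w v ->
  exists x k, w = inr (x, k) /\
    (in_copy x u /\ v = inl x \/ in_copy x v /\ u = inl x).
Proof.
move=> uv; case: w => [x|[x k]] duv.
  by case/eqP: uv; have := odd_dist_inl x u; rewrite duv odd_dist_inl => /addbI.
exists x, k; split=> //.
have [ux|ux] := boolP (in_copy x u).
  by left; rewrite (equidistant_from_copy uv ux duv).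
have [vx|vx] := boolP (in_copy x v).
  by right; rewrite (equidistant_from_copy _ vx (esym duv)) // eq_sym.
case/eqP: uv; have := odd_dist_copy k ux.
by rewrite duv odd_dist_copy // => /addbI.
Qed.

Lemma side_equalizer (h0 : H) :
  distance_equalizer [set z : V | side z].
Proof.
apply/forall_inP=> u; rewrite !inE => nu.
apply/forall_inP=> v; rewrite !inE => nv; apply/implyP=> uv.
suff [w sw dw] : exists2 w, side w & dist w u = dist w v.
  by apply/existsP; exists w; rewrite inE sw dw eqxx.
have [/andP[ux vx]|ncopy] := boolP (in_copy (base u) u && in_copy (base u) v).
  case: u nu ux vx {uv} => [//|[x h]] /=; rewrite negbK => cx _ vx.
  exists (inl x) => //=; case: v vx {nv} => [//|[y k]] /= /eqP->.
  by rewrite !(dist_sym Vc (inl x)) !corona_dist_copy.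
have even_uv : ~~ odd (dist u v).
  case: u nu ncopy {uv} => [x|[x h]] /= nu; rewrite ?eqxx /= => ncopy.
    by rewrite odd_dist_inl (negPf nu) (negPf nv).
  by rewrite odd_dist_copy // (negPf nu) (negPf nv).
have [w [duw dwv]] : exists w, dist u w = (dist u v)./2 /\ dist w v = (dist u v)./2.
  by apply: dist_split; rewrite // addnn even_halfK.
have {duw} dwu : dist w u = dist w v by rewrite (dist_sym Vc) duw dwv.
have [sw|nw] := boolP (side w); first by exists w.
case: w nw dwu dwv => [b|[a h]] /= nw dwu dwv.
  (* Neither [u] nor [v] lies in the copy at [b], whose colour is the other one, so both distances
     grow by one. *)
  exists (inr (b, h0)); first by [].
  by rewrite !corona_dist_copy ?dwu //;
    [apply: contra nv | apply: contra nu] => /in_copy_side->.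
(* If [u'] were in the copy at [a], it would be as far from [v'] as the midpoint is, so the whole
   distance would equal its half and vanish. *)
have far u' v' : u' != v' -> dist (inr (a, h) : V) v' = (dist u' v')./2 ->
    ~~ odd (dist u' v') -> ~~ in_copy a v' -> ~~ in_copy a u'.
  move=> uv' dv' ev' va; case: u' uv' dv' ev' => [//|[x k]] /= uv' dv' ev'.
  apply: contra uv' => /eqP xa; apply/eqP/(dist_eq0 Vc).
  move: dv' ev'; rewrite xa !corona_dist_copy //; lia.
have /nandP nboth : ~~ (in_copy a u && in_copy a v).
  apply: contra ncopy; case: u {nu uv even_uv dwu dwv} => [//|[x k]] /=.
  by case/andP=> /eqP-> ->; rewrite eqxx.
have [ua va] : ~~ in_copy a u /\ ~~ in_copy a v.
  case: nboth => na; split=> //.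
    by apply: far na; rewrite 1?eq_sym // (dist_sym Vc v u) // dwu.
  exact: far na.
exists (inl a); first by move: nw; rewrite negbK.
by apply: succn_inj; rewrite -!(corona_dist_copy h).
Qed.

Lemma card_side (b : bool) :
  #|[set z : V | side z == b]| =
    #|[set x | c x == b]| + #|[set x | c x == ~~ b]| * #|H|.
Proof.
rewrite -[#|H|]cardsT -cardsX.
have injl : injective (inl : G -> V) by move=> ? ? [].
have injr : injective (inr : G * H -> V) by move=> ? ? [].
rewrite -(card_imset _ injl) -(card_imset _ injr) -cardsUI (_ : _ :&: _ = set0).
  rewrite cards0 addn0; apply: eq_card => -[x|[x h]]; rewrite !inE /=.
    rewrite mem_imset // inE orbC; case: imsetP => [[? _]|//]; by [].
  rewrite [X in _ || X]mem_imset // !inE /= andbT.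
  by case: imsetP => [[? _]|_] //=; case: (c x) b => [] [].
apply/setP=> z; rewrite !inE; apply/negP=> /andP[/imsetP[x _ ->]].
by case/imsetP.
Qed.

Lemma mixed_equalizer_card (S : {set V}) u v :
    distance_equalizer S -> u \notin S -> v \notin S -> side u != side v ->
  #|~: S| <= #|H|.
Proof.
move=> /forall_inP eqS.
have {eqS} cross u' v' : u' \notin S -> v' \notin S -> side u' != side v' ->
    exists x k, inr (x, k) \in S /\
      (in_copy x u' /\ v' = inl x \/ in_copy x v' /\ u' = inl x).
  move=> u'S v'S suv; have := eqS u'; rewrite inE => /(_ u'S)/forall_inP/(_ v').
  rewrite inE => /(_ v'S)/implyP.
  have -> : u' != v' by apply: contraNneq suv => ->.
  case/(_ isT)/existsP=> w /andP[wS /eqP/(equidistant_opposite_sides suv)].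
  by case=> x [k [wE xk]]; exists x, k; rewrite -wE.
(* The two alternatives of [cross] differ only by exchanging [u] and [v]. *)
suff main x k u' v' : u' \notin S -> v' \notin S -> side u' != side v' ->
    inr (x, k) \in S -> in_copy x u' -> v' = inl x -> #|~: S| <= #|H|.
  move=> uS vS suv; have [x [k [kS [[xu vE]|[xv uE]]]]] := cross u v uS vS suv.
    exact: (main x k u v).
  by apply: (main x k v u) => //; rewrite eq_sym.
move=> u'S v'S suv kS xu vE.
(* As [inr (x, k)] is in [S], the index [k] is free to encode [inl x]; the image of [g] will cover
   the complement of [S]. *)
pose g (h : H) : V := if h == k then inl x else inr (x, h).
apply: leq_trans (leq_imset_card g H).
apply/subset_leq_card/subsetP=> z; rewrite inE => zS.
have [zE|zv] := eqVneq z (inl x).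
  by apply/imsetP; exists k; rewrite // /g eqxx.
have zx : in_copy x z.
  (* Compare [z] with whichever of [u'], [v'] has the opposite colour; either pair is tied to the
     same [x]. *)
  have [szv|szv] := eqVneq (side z) (side v').
    have suz : side u' != side z by rewrite szv.
    have [y [l [_ [[yu zE]|[yz uE]]]]] := cross u' z u'S zS suz.
      case: u' xu yu {u'S suv suz} => [//|[t m]] /= /eqP-> /eqP xy.
      by rewrite zE -xy eqxx in zv.
    by rewrite uE in xu.
  have [y [l [_ [[yz vE']|[yv zE]]]]] := cross z v' zS v'S szv.
    by move: vE'; rewrite vE => -[->].
  by rewrite vE in yv.
case: z zx zS {zv} => [//|[t h]] /= /eqP-> zS; apply/imsetP; exists h => //.
by rewrite /g ifN //; apply: contraNneq zS => ->.
Qed.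

End Sides.
End CoronaDistance.

(** * Comparison of the bounds *)

Theorem theorem26 (G : sgraph) (A B : {set G}) (H : sgraph)
    (Gconn : connected_graph G) (GAB : bipartition A B)
    (leBA : #|B| <= #|A|) (Hne : 0 < graph_order H) :
  xi (corona G H) = #|B| * graph_order H + #|A|.
Proof.
case: Gconn => Gne Gc; case: GAB => covAB disAB indA indB.
have BE : B = ~: A.
  apply/setP=> x; rewrite inE; have := in_setT x; rewrite -covAB inE.
  by have [xA _|//] := boolP (x \in A); rewrite (disjointFr disAB xA).
pose c x := x \in A.
have cP (x y : G) : adj x y -> c x = ~~ c y.
  rewrite /c => xy; have [xA|xA] := boolP (x \in A).
    by apply/esym/negP=> yA; have := indA x y xA yA; rewrite xy.
  apply/esym/negP => yA.
  by have := indB x y; rewrite BE !inE xy => /(_ xA (introN idP yA)).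
have cardA : #|[set x | c x == true]| = #|A|.
  by apply: eq_card => x; rewrite inE /c eqb_id.
have cardB : #|[set x | c x == false]| = #|B|.
  by rewrite BE; apply: eq_card => x; rewrite !inE /c eqbF_neg.
have cardT := @card_side G H c true; have cardF := @card_side G H c false.
rewrite /= cardA cardB in cardT cardF.
have cardAB : #|A| + #|B| = graph_order G by rewrite BE cardsC.
pose T := [set z : corona G H | side c z].
have TE : #|T| = #|B| * graph_order H + #|A|.
  by rewrite addnC -cardT; apply: eq_card => z; rewrite !inE eqb_id.
have TcE : #|~: T| = #|B| + #|A| * graph_order H.
  by rewrite -cardF; apply: eq_card => z; rewrite !inE eqbF_neg.
rewrite -TE; apply: xi_eq; first by have /card_gt0P[h _] := Hne; apply: side_equalizer.
move=> S eqS; have [/subset_leq_card//|/subsetPn[u]] := boolP (T \subset S).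
rewrite inE => su uS.
have [/subset_leq_card|/subsetPn[v]] := boolP (~: T \subset S).
  (* The two class sizes differ by (|A| - |B|)(n(H) - 1), which is nonnegative. *)
  apply: leq_trans; rewrite TE TcE; nia.
rewrite !inE => sv vS.
have := mixed_equalizer_card Gc cP eqS uS vS.
rewrite su (negPf sv) => /(_ isT).
(* [A] is nonempty because [G] is and |B| <= |A|. So the complement of [S] is no larger than that of
   [T]. *)
have : #|H| <= #|A| * #|H| by apply: leq_pmull; lia.
have := cardsC S; have := cardsC T; rewrite TcE /graph_order; lia.
Qed.
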